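(* Let $G$ be a simple undirected graph in which every vertex has finite degree. Then $G$ has a DET:IC if and only if all of the following hold: (i) $\delta(G) \ge 1$ (every vertex of $G$ has degree at least 1); (ii) $G$ is open-twin-free; (iii) for every edge $uv \in E(G)$, $\deg(u) \ge t+3$ or $\deg(v) \ge t+3$, where $t$ is the number of triangles of $G$ containing the edge $uv$.
   Context: For a vertex $v$, $N(v)$ is the set of vertices adjacent to $v$ and $N[v] = N(v)\cup\{v\}$. For $S \subseteq V(G)$, write $N_S[v] = N[v]\cap S$. A set $S \subseteq V(G)$ is an error-detecting identifying code (DET:IC) of $G$ if $|N_S[v]| \ge 2$ for every $v \in V(G)$ (every vertex is at least 2-dominated), and for all distinct $u,v \in V(G)$, $|N_S[u] - N_S[v]| \ge 2$ or $|N_S[v] - N_S[u]| \ge 2$ (all pairs are $2^\#$-distinguished). Two distinct vertices $u,v$ are open twins if $N(u)=N(v)$; $G$ is open-twin-free if it has no pair of open twins. *)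

(* Defs.v *)
From mathcomp Require Import all_boot finmap.
From mathcomp Require Import boolp classical_sets functions cardinality.

Set Implicit Arguments.
Unset Strict Implicit.
Unset Printing Implicit Defensive.

Local Open Scope classical_set_scope.
Local Open Scope nat_scope.

(* A simple undirected graph, possibly infinite, is a symmetric irreflexive
   relation [e : rel V].  [fset_set A] is empty when [A] is infinite, so [cardf]
   is the cardinality on finite sets only; [finite_closed_nbhd] and
   [finite_edge_triangles] below show that it is meaningful here. *)
Definition cardf (T : choiceType) (A : set T) : nat := #|` fset_set A |%fset.

Section Graph.
Context (V : choiceType) (e : rel V).
Implicit Types (S : set V) (u v w x y : V).

Definition nbhd v : set V := [set w | e v w].

Definition closed_nbhd v : set V := nbhd v `|` [set v].

Definition locally_finite : Prop := forall v, finite_set (nbhd v).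

Definition deg v : nat := cardf (nbhd v).

Definition code_nbhd S v : set V := closed_nbhd v `&` S.

Definition det_ic S : Prop :=
  (forall v, 2 <= cardf (code_nbhd S v)) /\
  (forall u v, u <> v ->
     2 <= cardf (code_nbhd S u `\` code_nbhd S v) \/
     2 <= cardf (code_nbhd S v `\` code_nbhd S u)).

Definition open_twins u v : Prop := u <> v /\ nbhd u = nbhd v.

Definition open_twin_free : Prop := forall u v, ~ open_twins u v.

Definition triangle (T : {fset V}) : Prop :=
  #|` T |%fset = 3 /\ {in T &, forall x y, x <> y -> e x y}.

Definition edge_triangles u v : set {fset V} :=
  [set T | [/\ triangle T, u \in T & v \in T]].

Lemma finite_closed_nbhd v : locally_finite -> finite_set (closed_nbhd v).
Proof. by move=> fin; rewrite finite_setU; split; [exact: fin|exact: finite_set1]. Qed.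

Lemma finite_edge_triangles u v :
  locally_finite -> finite_set (edge_triangles u v).
Proof.
move=> fin.
apply: (@sub_finite_set _ _ [set` fpowerset (fset_set (closed_nbhd u))]);
  last exact: finite_fset.
move=> T [[_ Te] uT vT] /=; rewrite fpowersetE; apply/fsubsetP => w wT.
rewrite in_fset_set; last exact: finite_closed_nbhd.
rewrite inE; have [->|/eqP wu] := eqVneq w u; first by right.
by left; apply: Te => // uw; apply: wu.
Qed.

End Graph.

(* Main.v *)
(** Enlarging a DET:IC keeps it one, so a DET:IC exists iff the whole vertex set
    is one.  For the whole vertex set, 2-domination is (i); a nonadjacent pair
    [u], [v] is distinguished iff [N(u)] and [N(v)] differ, as [u] itself lies in
    [N[u] - N[v]]; and for an edge [uv] in [t] triangles
    [|N[u] - N[v]| = deg u - t - 1]. *)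

Require Import Defs.
From mathcomp Require Import all_boot finmap.
From mathcomp Require Import boolp classical_sets functions cardinality.

Set Implicit Arguments.
Unset Strict Implicit.
Unset Printing Implicit Defensive.

Local Open Scope classical_set_scope.
Local Open Scope nat_scope.

Section FiniteCardinal.
Context (T : choiceType).
Implicit Types (A B : set T) (x : T).

(** Finiteness of [B] matters: [cardf] takes the default value 0 on infinite sets. *)
Lemma leq_cardf A B : finite_set B -> A `<=` B -> cardf A <= cardf B.
Proof.
move=> finB AB; apply: fsubset_leq_card.
by rewrite -fset_set_sub //; exact: sub_finite_set AB finB.
Qed.

Lemma cardfU1 A x : finite_set A -> ~ A x -> cardf (A `|` [set x]) = (cardf A).+1.
Proof.
move=> finA Ax; rewrite /cardf setUC fset_setU1 // cardfsU1 in_fset_set //.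
by rewrite memNset.
Qed.

Lemma cardfID A B : finite_set A -> finite_set B ->
  cardf (A `&` B) + cardf (A `\` B) = cardf A.
Proof. by move=> finA finB; rewrite /cardf fset_setI // fset_setD // cardfsID. Qed.

Lemma cardf_gt0 A : finite_set A -> 0 < cardf A <-> A !=set0.
Proof.
move=> finA; rewrite cardfs_gt0; split.
  by case/fset0Pn => x; rewrite in_fset_set // inE; exists x.
by case=> x Ax; apply/fset0Pn; exists x; rewrite in_fset_set // inE.
Qed.

End FiniteCardinal.

Section Graph.
Context (V : choiceType) (e : rel V).
Hypotheses (e_sym : symmetric e) (e_irr : irreflexive e).
Hypothesis e_fin : locally_finite e.
Implicit Types (S : set V) (u v w : V).

(** Since [(N[a] & S) - (N[b] & S) = (N[a] - N[b]) & S], each set counted in [det_ic] can only grow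
    when [S] is enlarged, and local finiteness keeps it finite. *)
Lemma det_ic_setT S : det_ic e S -> det_ic e [set: V].
Proof.
have fin v : finite_set (closed_nbhd e v) by exact: finite_closed_nbhd.
case=> dom dist; split=> [v|u v uv].
  apply: (leq_trans (dom v)); apply: leq_cardf; first exact: finite_setIl.
  by move=> x [].
have le a b : cardf (code_nbhd e S a `\` code_nbhd e S b) <=
    cardf (code_nbhd e setT a `\` code_nbhd e setT b).
  apply: leq_cardf; first exact/finite_setD/finite_setIl.
  by move=> x [[ax Sx] nbx]; split=> // -[bx _]; apply: nbx.
by case: (dist u v uv) => h; [left|right]; apply: leq_trans h (le _ _).
Qed.

Lemma cardf_closed_nbhd v : cardf (closed_nbhd e v) = (deg e v).+1.
Proof. by rewrite cardfU1 // /nbhd /= e_irr. Qed.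

(** A triangle on the edge [uv] is determined by its third vertex, which is a common neighbour of
    [u] and [v]. *)
Lemma edge_trianglesE u v : e u v ->
  edge_triangles e u v =
    [set [fset u; v; w]%fset | w in nbhd e u `&` nbhd e v].
Proof.
move=> euv; have neq x y : e x y -> x != y.
  by apply: contraTneq => ->; rewrite e_irr.
apply/seteqP; split=> [T [[T3 Te] uT vT]|_ [w [/= euw evw] <-]].
  have vTu : v \in (T `\ u)%fset by rewrite !inE vT eq_sym neq.
  (* Removing [u] and [v] from the three vertices of [T] leaves exactly the third vertex [w]. *)
  have /cardfs1P[w Tw] : #|` (T `\ u `\ v)%fset| == 1.
    by move: T3; rewrite (cardfsD1 u) uT (cardfsD1 v) vTu => /eqP; rewrite !add1n !eqSS.
  have : w \in (T `\ u `\ v)%fset by rewrite Tw inE.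
  rewrite !inE => /and3P[/eqP wv /eqP wu wT].
  exists w; first by split; apply: Te => //; exact/nesym.
  by rewrite -(fsetD1K uT) -(fsetD1K vTu) Tw fsetUA.
split; rewrite ?inE ?eqxx ?orbT //; split.
  rewrite fsetUC cardfsU1 cardfs2 !inE.
  by rewrite ![w == _]eq_sym !negb_or !neq.
by move=> x y; rewrite !inE -!orbA => /or3P[] /eqP-> /or3P[] /eqP-> //; rewrite e_sym.
Qed.

(** The map from [w] to [{u, v, w}] is injective on common neighbours: [w] belongs to [{u, v, w'}]
    and, there being no loops, is neither [u] nor [v], so it is [w']. *)
Lemma cardf_edge_triangles u v : e u v ->
  cardf (edge_triangles e u v) = cardf (nbhd e u `&` nbhd e v).
Proof.
move=> euv; rewrite /cardf edge_trianglesE //.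
have fin : finite_set (nbhd e u `&` nbhd e v) by exact: finite_setIl.
rewrite fset_set_image //; apply/eqP/card_in_imfsetP => w w'.
rewrite !in_fset_set // !inE /nbhd => -[/= euw evw] _ /fsetP/(_ w).
rewrite !inE eqxx orbT => /esym /orP[/orP[]|] /eqP // wE.
- by rewrite wE e_irr in euw.
- by rewrite wE e_irr in evw.
Qed.

(** For adjacent [u] and [v], [N[u] & N[v]] consists of the [t] common neighbours together with [u]
    and [v] themselves, so it takes [t + 2] of the [deg u + 1] elements of [N[u]]. *)
Lemma cardf_closed_nbhdD_edge u v : e u v ->
  cardf (closed_nbhd e u `\` closed_nbhd e v) + cardf (edge_triangles e u v) + 1
  = deg e u.
Proof.
(* Adding one to both sides turns [deg e u] into the size of [N[u]], which splits along [N[v]]. *)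
move=> euv; apply: succn_inj.
have fin x : finite_set (closed_nbhd e x) by exact: finite_closed_nbhd.
rewrite -cardf_closed_nbhd -(cardfID (fin u) (fin v)) cardf_edge_triangles //.
suff -> : closed_nbhd e u `&` closed_nbhd e v =
    (nbhd e u `&` nbhd e v) `|` [set u] `|` [set v].
  have finI : finite_set (nbhd e u `&` nbhd e v) by exact: finite_setIl.
  rewrite !cardfU1 //; first by rewrite -addnA addnC addn1 addSn addSn.
  - by rewrite /nbhd /= e_irr => -[].
  - by rewrite finite_setU; split=> //; exact: finite_set1.
  - rewrite /nbhd /= e_irr => -[[]//|vu].
    by rewrite vu e_irr in euv.
rewrite /closed_nbhd /nbhd; apply/seteqP; split=> x /=; first by tauto.
have evu : e v u by rewrite e_sym.
by case=> [[[]|->]|->]; tauto.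
Qed.

(** Nonadjacency puts [u] in the difference, and removing [v] along with [N(v)] costs nothing
    because [v] is not in [N(u)]. *)
Lemma cardf_closed_nbhdD_nonedge u v : u <> v -> ~~ e u v ->
  cardf (closed_nbhd e u `\` closed_nbhd e v) =
  (cardf (nbhd e u `\` nbhd e v)).+1.
Proof.
move=> uv /negP neuv.
suff -> : closed_nbhd e u `\` closed_nbhd e v =
    (nbhd e u `\` nbhd e v) `|` [set u].
  rewrite cardfU1 //; first exact: finite_setD.
  by rewrite /nbhd /= e_irr => -[].
rewrite /closed_nbhd /nbhd; apply/seteqP; split=> x /=; first by tauto.
case=> [[eux nevx]|->]; split; [by left| |by right|].
- by case=> // xv; apply: neuv; rewrite -xv.
- by rewrite e_sym => -[].
Qed.

(** The 3 is the required 2 plus 1 for [v], a neighbour of [u] that lies neither in [N[u] - N[v]]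
    nor among the common neighbours. *)
Lemma distinguished_edge u v : e u v ->
  2 <= cardf (closed_nbhd e u `\` closed_nbhd e v) <->
  cardf (edge_triangles e u v) + 3 <= deg e u.
Proof.
by move=> /cardf_closed_nbhdD_edge <-; rewrite -addnA addnCA leq_add2l (leq_add2r 1 2).
Qed.

(** One of the two required vertices is [u]; the other must be a neighbour of [u] outside [N(v)]. *)
Lemma distinguished_nonedge u v : u <> v -> ~~ e u v ->
  2 <= cardf (closed_nbhd e u `\` closed_nbhd e v) <->
  ~ (nbhd e u `<=` nbhd e v).
Proof.
move=> uv euv; rewrite cardf_closed_nbhdD_nonedge // ltnS.
rewrite cardf_gt0; last exact: finite_setD.
by split=> [[x [ux nvx]] /(_ x ux)|/nonsubset].
Qed.

Lemma edge_trianglesC u v : edge_triangles e u v = edge_triangles e v u.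
Proof. by apply/seteqP; split=> T []. Qed.

Lemma det_ic_setTE : det_ic e [set: V] <->
  (forall v, 2 <= cardf (closed_nbhd e v)) /\
  (forall u v, u <> v ->
     2 <= cardf (closed_nbhd e u `\` closed_nbhd e v) \/
     2 <= cardf (closed_nbhd e v `\` closed_nbhd e u)).
Proof.
have codeT v : code_nbhd e [set: V] v = closed_nbhd e v by exact: setIT.
split=> -[dom dist]; split=> [v|u v uv].
- by rewrite -codeT.
- by rewrite -!codeT; exact: dist.
- by rewrite codeT.
- by rewrite !codeT; exact: dist.
Qed.

End Graph.

Theorem theorem2p2 (V : choiceType) (e : rel V)
    (e_sym : symmetric e) (e_irr : irreflexive e) (e_fin : locally_finite e) :
  (exists S : set V, det_ic e S) <->
  [/\ (forall v : V, 1 <= deg e v),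
      open_twin_free e &
      forall u v : V, e u v ->
        cardf (edge_triangles e u v) + 3 <= deg e u \/
        cardf (edge_triangles e u v) + 3 <= deg e v].
Proof.
split=> [[S /(det_ic_setT e_fin)/det_ic_setTE[dom dist]]|[deg1 notwins edges]].
  split=> [v|u v [uv Nuv]|u v euv].
  - by have := dom v; rewrite cardf_closed_nbhd.
  (* Open twins are nonadjacent: [v] in [N(u) = N(v)] would be a loop. Distinguishing them in either
     direction then contradicts [N(u) = N(v)]. *)
  - have neuv : ~~ e u v.
      apply/negP; change (~ nbhd e u v).
      by rewrite Nuv /nbhd /= e_irr.
    have nevu : ~~ e v u by rewrite e_sym.
    have vu : v <> u by exact/nesym.
    by case: (dist u v uv) => /distinguished_nonedge ND; apply: ND => //;
      rewrite Nuv.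
  - have evu : e v u by rewrite e_sym.
    have uv : u <> v by move=> uv; rewrite uv e_irr in euv.
    case: (dist u v uv) => d; [left|right; rewrite edge_trianglesC];
      exact/distinguished_edge.
exists [set: V]; apply/det_ic_setTE; split=> [v|u v uv].
  by rewrite cardf_closed_nbhd // ltnS.
have [euv|neuv] := boolP (e u v).
  have evu : e v u by rewrite e_sym.
  by case: (edges u v euv) => d; [left|right; move: d; rewrite edge_trianglesC => d];
    exact/distinguished_edge.
have nevu : ~~ e v u by rewrite e_sym.
(* For a nonadjacent pair, a failing inclusion of [N(u)] in [N(v)] distinguishes on the side of [u].
   Otherwise the reverse inclusion must fail, or the two would be open twins. *)
have [Nuv|] := pselect (nbhd e u `<=` nbhd e v); last first.
  by left; exact/distinguished_nonedge.
right; apply/distinguished_nonedge => //; first exact/nesym.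
by move=> Nvu; apply: (notwins u v); split=> //; exact/seteqP.
Qed.
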